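(* For every LCL problem $\Pi$ on any family of graphs of bounded degree, the following chain of inequalities holds up to constant multiplicative factors (depending only on $\Pi$): $$\mathsf{MRad}\ \le\ \exists\mathsf{MVol}\ \le\ \mathsf{EMVol}\ \le\ \mathsf{DMVol}\ \le\ |N_{\mathsf{MRad}}|.$$ That is, for each pair of consecutive measures $X\le Y$ in this chain and each function $T$, if $\Pi$ has $Y=O(T)$ then $\Pi$ has $X=O(T)$.
   Context: All graphs have maximum degree bounded by a constant. An LCL problem $\Pi=(\Sigma,\mathcal G,\phi)$ consists of a finite label set $\Sigma$, a class $\mathcal G$ of input graphs, and a local verifier $\phi$ of constant radius $r$: $\phi(G,\lambda,v)\in\{\text{happy},\text{unhappy}\}$ depends only on the isomorphism type of the labeled radius-$r$ neighborhood of $v$. A partial solution is a labeling $\lambda:V(G)\to\Sigma\sqcup\{\bot\}$ such that every vertex with no $\bot$ within distance $r$ is happy. A hole is a vertex labeled $\bot$. A mend of $\lambda$ at a hole $v$ is a partial solution $\lambda'$ with $\lambda'(v)\neq\bot$ and $\lambda'(u)\neq\bot$ whenever $\lambda(u)\ne\bot$. Mends are assumed to always exist. $\exists\mathsf{MVol}$ (existential mending volume), on $n$-vertex instances: $\max_{G,\lambda,v}\min\{|\{u:\lambda(u)\neq\lambda'(u)\}|:\lambda'\text{ mend of }\lambda\text{ at }v\}$. A set $W\subseteq V(G)$ contains a mend of $\lambda$ at $v$ if some mend $\lambda'$ of $\lambda$ at $v$ satisfies $\{u:\lambda'(u)\ne\lambda(u)\}\subseteq W$. A (local) mender $\mathcal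 M$ assigns to each $(G,\lambda,v)$ a Markov chain $\mathcal M_{G,\lambda,v}$ on subsets of $V(G)$ such that: (progress) $\mathcal M_{G,\lambda,v}(W,W')>0$ implies $W\subseteq W'$; (termination) $\mathcal M_{G,\lambda,v}(W,W)=1$ iff $W$ contains a mend of $\lambda$ at $v$; (locality) $\mathcal M_{G,\lambda,v}(W,\cdot)$ depends only on $W$ and its direct neighborhood. In the exploration model only neighbors of already explored vertices can be newly explored, so states reached from $\{v\}$ are connected. The chain is absorbing; $\mathcal M^*_{G,\lambda,v}(\{v\},\cdot)$ is its limiting distribution started at $\{v\}$, and $\mathcal F=\mathcal F^{\mathcal M}_{G,\lambda,v}(\{v\})$ is the set of absorbing (final) states reachable from $\{v\}$. Then $\mathsf{EMVol}(\mathcal M,G)=\max_{\lambda,v}\sum_{W_F}\mathcal M^*_{G,\lambda,v}(\{v\},W_F)|W_F|$, $\mathsf{DMVol}(\mathcal M,G)=\max_{\lambda,v}\max_{W_F\in\mathcal F}|W_F|$, $\mathsf{MRad}(\mathcal M,G)=\max_{\lambda,v}\min_{W_F\in\mathcal F}\max_{w\in W_F}\mathrm{dist}(v,w)$. For each such measure $X$: $\Pi$ has $X=O(T)$ if there is a mender $\mathcal M$ with $X(\mathcal M,G_n)=O(T(n))$ on all instances $G_n\in\mathcal G$ of size $n$; $\Pi$ has $X=\Omega(T)$ if for every mender $\mathcal M$ there are instances $G_n$ of size $n$ with $X(\mathcal M,G_n)=\Omega(T(n))$. $|N_{\mathsf{MRad}}|$ is the maximum number of vertices in a neighborhood of radius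 $\mathsf{MRad}$ (of the optimal mender) in an instance of size $n$.
   Formalization: Locality of a mender is taken as dependence on the radius max(1,2r) neighborhood of W (r the verifier radius) rather than only its direct neighborhood, since otherwise some LCLs have no mender and the claim fails; newly explored vertices are still direct neighbors. *)

(* Defs.v *)
From HB Require Import structures.
From mathcomp Require Import all_boot all_order all_algebra.
From mathcomp Require Import all_classical all_reals all_analysis.

Set Implicit Arguments.
Unset Strict Implicit.
Unset Printing Implicit Defensive.

Import Order.TTheory GRing.Theory Num.Theory.
Import numFieldNormedType.Exports.

Local Open Scope ring_scope.

Record sgraph := SGraph {
  vertex :> finType;
  adj : rel vertex;
  adj_sym : symmetric adj;
  adj_irrefl : irreflexive adj
}.

Section Graphs.
Variable G : sgraph.

Definition degree (u : G) : nat := #|[set w | adj u w]|.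

Definition cnbhd (A : {set G}) : {set G} :=
  A :|: [set w | [exists u in A, adj u w]].

(* The vertices at distance at most k from A. *)
Definition nball (k : nat) (A : {set G}) : {set G} := iter k cnbhd A.

(* The least k with w in the radius-k ball around u; if u and w lie in
   different components, the value is #|G|, which exceeds every finite
   distance. *)
Definition dist (u w : G) : nat :=
  find (fun k => w \in nball k [set u]) (iota 0 #|G|).

End Graphs.

(* f restricts to an isomorphism from the subgraph of G induced by A, labeled
   by l, onto the subgraph of H induced by B, labeled by m. *)
Definition labeled_iso (L : Type) (G H : sgraph) (A : {set G}) (B : {set H})
    (l : G -> L) (m : H -> L) (f : G -> H) : Prop :=
  [/\ {in A &, injective f}, f @: A = B,
      {in A &, forall x y, adj (f x) (f y) = adj x y} &
      {in A, forall x, m (f x) = l x}].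

(* In a labeling, None stands for the missing label "bot". *)
Definition labeling (S : finType) (G : sgraph) := {ffun G -> option S}.

Record lcl := LCL {
  alphabet : finType;
  instances : sgraph -> Prop;
  radius : nat;
  happy : forall G : sgraph, labeling alphabet G -> G -> bool;
  happy_local : forall (G H : sgraph) (l : labeling alphabet G)
      (m : labeling alphabet H) (u : G) (f : G -> H),
    labeled_iso (nball radius [set u]) (nball radius [set f u]) l m f ->
    happy m (f u) = happy l u
}.

Section Mending.
Variables (Pi : lcl) (G : sgraph).
Implicit Types (l : labeling (alphabet Pi) G) (v : G) (W : {set G}).

Definition partial_solution l : bool :=
  [forall u, [forall w in nball (radius Pi) [set u], l w != None] ==>
             happy l u].

Definition hole l v : bool := l v == None.

Definition mend l v l' : bool :=
  [&& partial_solution l', l' v != None &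
      [forall u, (l u != None) ==> (l' u != None)]].

Definition changed l l' : {set G} := [set u | l u != l' u].

Definition contains_mend l v W : bool :=
  [exists l', mend l v l' && (changed l l' \subset W)].

(* The pairs (l, v) over which the maxima defining the measures range. *)
Definition admissible (p : labeling (alphabet Pi) G * G) : bool :=
  partial_solution p.1 && hole p.1 p.2.

(* The minimum is over the mends of l at v; the neutral element #|G| of the
   iterated minimum is an upper bound of #|changed l l'|. *)
Definition existsMVol : nat :=
  \max_(p | admissible p)
    \big[minn/#|G|]_(l' | mend p.1 p.2 l') #|changed p.1 l'|.

End Mending.

Arguments existsMVol : clear implicits.

Definition bounded_degree (Pi : lcl) : Prop :=
  exists D : nat, forall G : sgraph, instances Pi G ->
    forall u : G, (degree u <= D)%N.

Definition always_mendable (Pi : lcl) : Prop :=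
  forall (G : sgraph) (l : labeling (alphabet Pi) G) (v : G),
    instances Pi G -> partial_solution l -> hole l v ->
    exists l', mend l v l'.

(* How far around W a mender sees. Whether W contains a mend depends on the
   happiness of the vertices within distance r of W, hence on the labels within
   distance 2r of W; with a smaller radius, locality would be incompatible with
   termination for some LCLs. A mender also sees the vertices adjacent to W,
   even if r = 0. *)
Definition view_radius (Pi : lcl) : nat := maxn 1 (2 * radius Pi).

(* In locality, the view carries the labels and a mark on the hole v.
   Exploration is only imposed on states containing v: these include all states
   reachable from [set v], whereas for the empty set it would contradict
   termination. *)
Record mender (R : realType) (Pi : lcl) := Mender {
  trans :> forall G : sgraph, labeling (alphabet Pi) G -> G ->
    {set G} -> {set G} -> R;
  trans_ge0 : forall (G : sgraph) (l : labeling (alphabet Pi) G) (v : G),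
    instances Pi G -> partial_solution l -> hole l v ->
    forall W W' : {set G}, 0 <= trans l v W W';
  trans_sum1 : forall (G : sgraph) (l : labeling (alphabet Pi) G) (v : G),
    instances Pi G -> partial_solution l -> hole l v ->
    forall W : {set G}, \sum_(W' : {set G}) trans l v W W' = 1;
  progress : forall (G : sgraph) (l : labeling (alphabet Pi) G) (v : G),
    instances Pi G -> partial_solution l -> hole l v ->
    forall W W' : {set G}, 0 < trans l v W W' -> W \subset W';
  termination : forall (G : sgraph) (l : labeling (alphabet Pi) G) (v : G),
    instances Pi G -> partial_solution l -> hole l v ->
    forall W : {set G}, trans l v W W = 1 <-> contains_mend l v W;
  exploration : forall (G : sgraph) (l : labeling (alphabet Pi) G) (v : G),
    instances Pi G -> partial_solution l -> hole l v ->
    forall W W' : {set G}, v \in W -> 0 < trans l v W W' -> W' \subset cnbhd W;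
  locality : forall (G H : sgraph) (l : labeling (alphabet Pi) G)
      (m : labeling (alphabet Pi) H) (v : G) (z : H),
    instances Pi G -> partial_solution l -> hole l v ->
    instances Pi H -> partial_solution m -> hole m z ->
    forall (W : {set G}) (Z : {set H}) (f : G -> H),
    labeled_iso (nball (view_radius Pi) W) (nball (view_radius Pi) Z)
      (fun x => (l x, x == v)) (fun y => (m y, y == z)) f ->
    f @: W = Z ->
    forall X : {set G}, X \subset nball (view_radius Pi) W ->
    trans m z Z (f @: X) = trans l v W X
}.

Section Measures.
Variables (R : realType) (Pi : lcl) (M : mender R Pi) (G : sgraph).
Implicit Types (l : labeling (alphabet Pi) G) (v : G) (W : {set G}).

Fixpoint trans_iter (k : nat) l v W W' : R :=
  if k is k'.+1 then \sum_(U : {set G}) M G l v W U * trans_iter k' l v U W'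
  else (W == W')%:R.

Definition limit_distribution l v W W' : R :=
  limn (fun k => trans_iter k l v W W').

Definition final_states l v : {set {set G}} :=
  [set W | connect (fun A B => 0 < M G l v A B) [set v] W & M G l v W W == 1].

Definition EMVol : R :=
  \big[Num.max/0]_(p | @admissible Pi G p)
    \sum_(W in final_states p.1 p.2)
      limit_distribution p.1 p.2 [set p.2] W * #|W|%:R.

Definition DMVol : nat :=
  \max_(p | @admissible Pi G p) \max_(W in final_states p.1 p.2) #|W|.

(* The neutral element #|G| of the iterated minimum bounds all distances. *)
Definition MRad : nat :=
  \max_(p | @admissible Pi G p)
    \big[minn/#|G|]_(W in final_states p.1 p.2) \max_(w in W) dist p.2 w.

Definition NMRad : nat := \max_(u : G) #|nball MRad [set u]|.

End Measures.

Definition optimal_mender (R : realType) (Pi : lcl) (M : mender R Pi) : Prop :=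
  forall (M' : mender R Pi) (G : sgraph), instances Pi G ->
    (MRad M G <= MRad M' G)%N.

(* X(G) = O(T(n)) on the instances G of size n, as n tends to infinity. *)
Definition bigO_instances (R : realType) (Pi : lcl) (X : sgraph -> R)
    (T : nat -> R) : Prop :=
  exists (C : R) (n0 : nat), forall G : sgraph, instances Pi G ->
    (n0 <= #|G|)%N -> X G <= C * `|T #|G| |.

Section UpperBounds.
Variables (R : realType) (Pi : lcl) (T : nat -> R).

Definition MRad_bigO : Prop :=
  exists M : mender R Pi, bigO_instances Pi (fun G => (MRad M G)%:R) T.

Definition existsMVol_bigO : Prop :=
  bigO_instances Pi (fun G => (existsMVol Pi G)%:R) T.

Definition EMVol_bigO : Prop :=
  exists M : mender R Pi, bigO_instances Pi (EMVol M) T.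

Definition DMVol_bigO : Prop :=
  exists M : mender R Pi, bigO_instances Pi (fun G => (DMVol M G)%:R) T.

(* The radius is MRad of the instance itself; taking instead its maximum over
   all instances of the same size gives larger neighborhoods, hence a stronger
   condition. *)
Definition NMRad_bigO : Prop :=
  exists M : mender R Pi, optimal_mender M /\
    bigO_instances Pi (fun G => (NMRad M G)%:R) T.

End UpperBounds.

(* Main.v *)
(** Consider the deterministic mender that grows the ball around the hole v by
    one layer until the ball contains a mend. If a mend l' changes c vertices,
    then for some k < c the shell between the balls of radii 2rk and 2r(k+1)
    around v contains no changed vertex, and undoing the changes outside the
    first ball leaves a mend, because no vertex sees changes on both sides of
    the shell. So the balls stop at radius at most 2r times the existential
    mending volume. Conversely, a final state of any mender contains a mend and
    lies in the ball of its own eccentricity around v, so the balls stop at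
    radius at most MRad of that mender; hence their volume is at most N_MRad.

    The middle inequalities hold for each mender separately, since its limiting
    distribution is a probability distribution on the final states: the expected
    size of the state is bounded and increases by at least (1 - P(U, U)) times
    the mass of each transient state U, so the transient mass tends to 0. *)

From mathcomp Require Import all_boot all_order all_algebra.
From mathcomp Require Import all_classical all_reals all_analysis.
Require Import Defs.

Set Implicit Arguments.
Unset Strict Implicit.
Unset Printing Implicit Defensive.

Import Order.TTheory GRing.Theory Num.Theory.
Import numFieldNormedType.Exports.

(** * Balls, distance and the self-duality of neighborhoods *)

Section Balls.
Variable G : sgraph.
Implicit Types (u v w : G) (A B : {set G}) (j k : nat).

Lemma in_cnbhd A w : (w \in cnbhd A) = (w \in A) || [exists u in A, adj u w].
Proof. by rewrite !inE. Qed.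

Lemma subset_cnbhd A : A \subset cnbhd A.
Proof. exact: finset.subsetUl. Qed.

Lemma cnbhdS A B : A \subset B -> cnbhd A \subset cnbhd B.
Proof.
move=> AB; apply/fintype.subsetP => w; rewrite !in_cnbhd.
case/orP=> [/(fintype.subsetP AB) -> //|/existsP[u /andP[uA uw]]].
by apply/orP; right; apply/existsP; exists u; rewrite (fintype.subsetP AB).
Qed.

Lemma nballS k A B : A \subset B -> nball k A \subset nball k B.
Proof. by move=> AB; elim: k => //= k; exact: cnbhdS. Qed.

Lemma nballD j k A : nball (j + k) A = nball j (nball k A).
Proof. exact: iterD. Qed.

Lemma subset_nball k A : A \subset nball k A.
Proof.
by elim: k => //= k IH; exact: fintype.subset_trans IH (subset_cnbhd _).
Qed.

Lemma leq_nball j k A : j <= k -> nball j A \subset nball k A.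
Proof. by move=> /subnK <-; rewrite nballD subset_nball. Qed.

Lemma mem_nball k v : v \in nball k [set v].
Proof. by apply: (fintype.subsetP (subset_nball k _)); rewrite inE. Qed.

Lemma nball_closed k A : cnbhd A = A -> nball k A = A.
Proof. by move=> cA; elim: k => //= k ->. Qed.

(** Adjacency is symmetric, so an edge from [A] into [B] can be charged to either side. Iterated,
    this trades balls around a vertex for balls around a set. *)
Lemma disjoint_cnbhd A B : [disjoint cnbhd A & B] = [disjoint A & cnbhd B].
Proof.
wlog suff imp : A B / [disjoint A & cnbhd B] -> [disjoint cnbhd A & B].
  apply/idP/idP; last exact: imp.
  by rewrite disjoint_sym => /imp; rewrite disjoint_sym.
rewrite !finset.disjoints_subset => /fintype.subsetP AB.
apply/fintype.subsetP => w; rewrite in_cnbhd inE => /orP[wA|].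
  apply: contraL (AB w wA) => wB; rewrite inE negbK.
  exact: (fintype.subsetP (subset_cnbhd B)).
case/existsP => u /andP[uA uw]; apply: contraL (AB u uA) => wB.
rewrite inE negbK in_cnbhd; apply/orP; right; apply/existsP; exists w.
by rewrite wB adj_sym.
Qed.

Lemma disjoint_nball k A B : [disjoint nball k A & B] = [disjoint A & nball k B].
Proof.
elim: k B => //= k IH B.
by rewrite disjoint_cnbhd IH -/(nball k (cnbhd B)) /nball -iterSr.
Qed.

Lemma disjoint_nball1 k u A : [disjoint nball k [set u] & A] = (u \notin nball k A).
Proof. by rewrite disjoint_nball finset.disjoints1. Qed.

Lemma dist_le k u w : w \in nball k [set u] -> dist u w <= k.
Proof.
(* For [k] at least [#|G|] the bound is automatic: [find] never exceeds the length of the list it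
   searches. *)
move=> wk; rewrite /dist; have [kG|Gk] := ltnP k #|G|; last first.
  by rewrite (leq_trans (find_size _ _)) ?size_iota.
rewrite leqNgt; apply/negP => /(before_find 0).
by rewrite nth_iota // add0n wk.
Qed.

Lemma mem_nball_dist u w : dist u w < #|G| -> w \in nball (dist u w) [set u].
Proof.
move=> dG; have: has (fun k => w \in nball k [set u]) (iota 0 #|G|).
  by rewrite has_find size_iota.
by move/(nth_find 0); rewrite nth_iota // add0n.
Qed.

(** A ball that is not closed under adjacency gains a vertex at the next layer, which can happen at
    most [#|G|] times; once closed, a ball stays constant. *)
Lemma cnbhd_nball_card A : cnbhd (nball #|G| A) = nball #|G| A.
Proof.
suff [k kG ck] : exists2 k, k <= #|G| & cnbhd (nball k A) = nball k A.
  by rewrite -(subnK kG) nballD (nball_closed _ ck).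
apply: contrapT => /forall2NP nck.
suff /(_ #|G|.+1 (leqnn _)) : forall k, k <= #|G|.+1 -> k <= #|nball k A|.
  by rewrite ltnNge max_card.
elim=> // k IH kG; apply: leq_ltn_trans (IH (ltnW kG)) _.
apply: proper_card; rewrite finset.properEneq subset_cnbhd andbT.
by case: (nck k) => // /eqP; rewrite eq_sym.
Qed.

End Balls.

(** * Transport of balls along local isomorphisms *)

Section Isomorphisms.
Variables (L : Type) (G H : sgraph) (N : {set G}) (N' : {set H}).
Variables (l : G -> L) (m : H -> L) (f : G -> H).
Hypothesis iso : labeled_iso N N' l m f.
Implicit Types (A B W : {set G}) (x : G) (i j k : nat).

Lemma labeled_iso_sub A (B : {set H}) : A \subset N -> f @: A = B -> labeled_iso A B l m f.
Proof.
case: iso => inj _ adjf lab /fintype.subsetP AN fAB; split => //.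
- by move=> x y xA yA; apply: inj; apply: AN.
- by move=> x y xA yA; apply: adjf; apply: AN.
- by move=> x xA; apply: lab; apply: AN.
Qed.

Lemma mem_iso_image A x : A \subset N -> x \in N -> (f x \in f @: A) = (x \in A).
Proof.
move=> /fintype.subsetP AN xN; case: iso => inj _ _ _.
apply/imsetP/idP => [[y yA fxy]|xA]; last by exists x.
by rewrite (inj x y xN (AN y yA) fxy).
Qed.

Lemma iso_imset_eq A B : A \subset N -> B \subset N ->
  (f @: A == f @: B) = (A == B).
Proof.
move=> AN BN; apply/eqP/eqP => [fAB|-> //]; apply/setP => x.
have [xN|xN] := boolP (x \in N).
  by rewrite -(mem_iso_image AN xN) fAB mem_iso_image.
rewrite (contraNF (fintype.subsetP AN x) xN).
by rewrite (contraNF (fintype.subsetP BN x) xN).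
Qed.

(** An isomorphism of induced subgraphs controls only the edges inside [N] and [N'], so the
    neighborhoods on both sides are required to lie there. *)
Lemma iso_cnbhd B : cnbhd B \subset N -> cnbhd (f @: B) \subset N' ->
  f @: cnbhd B = cnbhd (f @: B).
Proof.
case: iso => inj fN adjf _ cBN cBN'.
have BN := fintype.subset_trans (subset_cnbhd B) cBN.
apply/setP => y; apply/imsetP/idP => [[x xB ->]|yB].
  rewrite in_cnbhd mem_iso_image ?(fintype.subsetP cBN) //.
  move: (xB); rewrite in_cnbhd => /orP[-> //|/existsP[u /andP[uB ux]]].
  apply/orP; right; apply/existsP; exists (f u); rewrite imset_f //=.
  by rewrite adjf ?(fintype.subsetP BN u uB) ?(fintype.subsetP cBN x xB).
have := fintype.subsetP cBN' y yB; rewrite -fN => /imsetP[x xN yx].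
exists x => //; move: yB; rewrite yx !in_cnbhd mem_iso_image //.
case/orP => [-> //|/existsP[_ /andP[/imsetP[u uB ->]]]].
rewrite adjf ?(fintype.subsetP BN u uB) // => ux.
by apply/orP; right; apply/existsP; exists u; rewrite uB.
Qed.

Lemma iso_nball W k j : N = nball k W -> N' = nball k (f @: W) ->
  j <= k -> f @: nball j W = nball j (f @: W).
Proof.
move=> NW NW'; elim: j => // j IH jk.
have IHj := IH (ltnW jk); rewrite [in RHS]/= -IHj; apply: iso_cnbhd.
  by rewrite NW (@leq_nball _ j.+1).
by rewrite NW' IHj (@leq_nball _ j.+1).
Qed.

(** The [j]-ball around [A] stays within distance [i + j] of [W], hence inside the region where [f]
    preserves edges. With [i] and [j] at most the verifier radius, this transports happiness
    balls. *)
Lemma iso_nball_sub W k i j A : N = nball k W -> N' = nball k (f @: W) ->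
  i + j <= k -> A \subset nball i W -> f @: nball j A = nball j (f @: A).
Proof.
move=> NW NW'; elim: j => // j IH jk AW.
rewrite addnS in jk.
have IHj := IH (ltnW jk) AW; rewrite [in RHS]/= -IHj.
have sub : nball j A \subset nball (i + j) W by rewrite addnC nballD nballS.
apply: iso_cnbhd.
  by rewrite NW (fintype.subset_trans (cnbhdS sub)) ?(@leq_nball _ (i + j).+1).
rewrite NW' (fintype.subset_trans (cnbhdS (imsetS f sub))) //.
by rewrite (iso_nball NW NW' (ltnW jk)) (@leq_nball _ (i + j).+1).
Qed.

Lemma labeled_iso_inv (x0 : G) : exists g : H -> G,
  labeled_iso N' N m l g /\ {in N, cancel f g}.
Proof.
case: iso => inj fN adjf lab.
(* The vertex [x0] is a dummy value for points without a preimage in [N]. *)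
pose g y := odflt x0 [pick x in N | f x == y].
have fK : {in N, cancel f g}.
  move=> x xN; rewrite /g; case: pickP => [x' /= /andP[x'N /eqP]|/(_ x)].
    exact: inj.
  by rewrite xN eqxx.
exists g; split => //; split.
- rewrite -fN => _ _ /imsetP[x xN ->] /imsetP[y yN ->].
  by rewrite !fK // => ->.
- rewrite -fN -imset_comp -[RHS]imset_id; apply: eq_in_imset => x xN.
  by rewrite /= fK.
- rewrite -fN => _ _ /imsetP[x xN ->] /imsetP[y yN ->].
  by rewrite !fK // adjf.
- by rewrite -fN => _ /imsetP[x xN ->]; rewrite fK // lab.
Qed.

End Isomorphisms.

(** * Gluing partial solutions and restricting mends *)

Section Mends.
Variable Pi : lcl.
Local Notation r := (radius Pi).

(** The gluing principle: happiness sees only an [r]-ball, so it suffices that each [r]-ball is a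
    copy of one in some partial solution, which may vary with [u] and live on another graph. *)
Lemma partial_solution_local (G : sgraph) (l : labeling (alphabet Pi) G) :
  (forall u, exists (H : sgraph) (m : labeling (alphabet Pi) H) (x : H)
      (f : H -> G), [/\ partial_solution m, f x = u &
        labeled_iso (nball r [set x]) (nball r [set u]) m l f]) ->
  partial_solution l.
Proof.
move=> loc; apply/forallP => u; apply/implyP => /forall_inP nobot.
have [H [m [x [f [/forallP/(_ x)/implyP mx fx iso]]]]] := loc u.
subst u; rewrite (@happy_local Pi _ _ _ _ _ _ iso); apply: mx; apply/forall_inP => w wx.
case: iso => _ im _ lab; rewrite -lab //; apply: nobot.
by rewrite -im imset_f.
Qed.

Lemma labeled_iso_id (L : Type) (G : sgraph) (A : {set G}) (l m : G -> L) :
  {in A, m =1 l} -> labeled_iso A A l m id.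
Proof. by move=> lm; split => //; rewrite imset_id. Qed.

Section OneGraph.
Variable G : sgraph.
Implicit Types (l : labeling (alphabet Pi) G) (v : G) (W A : {set G}).

Lemma contains_mendS l v W W' :
  W \subset W' -> contains_mend l v W -> contains_mend l v W'.
Proof.
move=> WW' /existsP[l' /andP[ml' cW]]; apply/existsP; exists l'.
by rewrite ml' (fintype.subset_trans cW).
Qed.

Lemma mem_contains_mend l v W : hole l v -> contains_mend l v W -> v \in W.
Proof.
move=> /eqP lv /existsP[l' /andP[/and3P[_ l'v _] /fintype.subsetP]]; apply.
by rewrite inE lv eq_sym.
Qed.

(* A happiness ball meeting [changed l l' :&: A] contains no changed vertex
   outside A, so it sees only l' or only l after the changes outside A are
   undone. *)
Lemma contains_mend_restrict l l' v A :
  partial_solution l -> mend l v l' -> v \in A ->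
  changed l l' :&: nball (2 * r) (changed l l' :&: A) \subset A ->
  contains_mend l v A.
Proof.
move=> psl /and3P[psl' l'v l'bot] vA sep.
pose l'' : labeling (alphabet Pi) G :=
  [ffun u => if u \in A then l' u else l u].
apply/existsP; exists l''; apply/andP; split; last first.
  apply/fintype.subsetP => u; rewrite inE ffunE; case: ifP => //.
  by rewrite eqxx.
apply/and3P; split; last first.
- apply/forallP => u; rewrite ffunE; case: ifP => _ //.
    exact: (forallP l'bot).
  exact/implyP.
- by rewrite ffunE vA.
apply: partial_solution_local => u; exists G.
case: (boolP (u \in nball r (changed l l' :&: A))) => uA.
- exists l', u, id; split=> //; apply: labeled_iso_id => w wu.
  rewrite ffunE; case: ifPn => // wA.
  apply/eqP/negP => /negP lw; case/negP: wA.
  apply: (fintype.subsetP sep); rewrite finset.in_setI inE lw /=.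
  rewrite mul2n -addnn nballD; apply: fintype.subsetP wu; apply: nballS.
  by rewrite finset.sub1set.
- exists l, u, id; split=> //; apply: labeled_iso_id => w wu.
  rewrite ffunE; case: ifP => // wA; apply/esym/eqP/negP => /negP lw.
  move: uA; rewrite -disjoint_nball1 => /pred0P/(_ w) /=.
  by rewrite wu finset.in_setI inE lw wA.
Qed.

(** A closed set is a union of components, so undoing the changes of a mend outside it is invisible
    from inside. *)
Lemma contains_mend_closed l v A : always_mendable Pi -> instances Pi G ->
  partial_solution l -> hole l v -> v \in A -> cnbhd A = A ->
  contains_mend l v A.
Proof.
move=> mendable iG psl hv vA cA.
have [l' ml'] := mendable G l v iG psl hv.
apply: (contains_mend_restrict psl ml' vA).
apply: fintype.subset_trans (finset.subsetIr _ _) _.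
by rewrite -{2}(nball_closed (2 * r) cA) nballS // finset.subsetIr.
Qed.

Lemma contains_mend_nball l l' v : partial_solution l -> hole l v ->
  mend l v l' -> contains_mend l v (nball (2 * r * #|changed l l'|) [set v]).
Proof.
move=> psl hv ml'; set S := changed l l'; set c := #|S|.
pose D k := nball (2 * r * k) [set v].
have vS : v \in S.
  by case/and3P: ml' => _ l'v _; rewrite inE (eqP hv) eq_sym.
(* Since [D k.+1] contains the [2r]-ball around the changes in [D k], a shell free of changes is the
   separation needed to restrict [l'] to [D k]. *)
suff [k kc cl] : exists2 k, k < c & S :&: D k.+1 \subset D k.
  apply: contains_mendS (leq_nball _ (leq_mul (leqnn _) (ltnW kc))) _.
  apply: (contains_mend_restrict psl ml' (mem_nball _ _)).
  apply: fintype.subset_trans _ cl; apply: finset.setIS.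
  by rewrite /D mulnSr addnC nballD nballS // finset.subsetIr.
apply: contrapT => /forall2NP no.
(* If every shell held a change, each [D k] would contain more than [k] changed vertices, which is
   too many at [k = c]. *)
suff /(_ c (leqnn _)) : forall k, k <= c -> k < #|S :&: D k|.
  by rewrite ltnNge subset_leq_card // finset.subsetIl.
elim=> [|k IH] kc.
  apply/card_gt0P; exists v; rewrite finset.in_setI vS.
  exact: mem_nball.
apply: leq_ltn_trans (IH (ltnW kc)) _; apply: proper_card.
rewrite fintype.properE finset.setIS ?leq_nball ?leq_mul //=.
apply/negP => /fintype.subset_trans/(_ (finset.subsetIr _ _)) sub.
by case: (no k).
Qed.

End OneGraph.

(** * Invariance of mends under isomorphism of views *)

Section IsoMend.
Variables (G H : sgraph) (l : labeling (alphabet Pi) G).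
Variables (m : labeling (alphabet Pi) H) (v : G) (z : H).
Hypotheses (psm : partial_solution m) (hv : hole l v).
Variables (W : {set G}) (Z : {set H}) (f : G -> H).
Hypothesis iso :
  labeled_iso (nball (view_radius Pi) W) (nball (view_radius Pi) Z)
      (fun x => (l x, x == v)) (fun y => (m y, y == z)) f.
Hypothesis fW : f @: W = Z.

(** The labels of a mend are copied from [W] to [Z] and [m] is kept elsewhere. The view radius is at
    least [2r], so it covers every happiness ball that meets [Z]. *)
Lemma iso_contains_mend : contains_mend l v W -> contains_mend m z Z.
Proof.
move=> mW; have vW := mem_contains_mend hv mW.
have WN := subset_nball (view_radius Pi) W.
have ball j :=
  @iso_nball_sub _ _ _ _ _ _ _ _ iso W _ r j _ erefl (f_equal _ (esym fW)).
have ballW j :=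
  @iso_nball _ _ _ _ _ _ _ _ iso W _ j erefl (f_equal _ (esym fW)).
have [g [_ fK]] := labeled_iso_inv iso v.
have [inj _ _ lab] := iso.
have labm x : x \in nball (view_radius Pi) W -> m (f x) = l x.
  by move=> /lab [].
have fv : f v = z.
  by have [_] := lab v (fintype.subsetP WN v vW); rewrite eqxx => /eqP.
case/existsP: mW => l' /andP[/and3P[psl' l'v /forallP l'bot] /fintype.subsetP cW].
have r2 : r + r <= view_radius Pi by rewrite addnn -mul2n leq_maxr.
pose m' : labeling (alphabet Pi) H :=
  [ffun y => if y \in Z then l' (g y) else m y].
(* The agreement extends from [W] to the whole view, because [l'] equals [l] outside [W] and [f]
   preserves the old labels. *)
have m'f x : x \in nball (view_radius Pi) W -> m' (f x) = l' x.
  move=> xN; rewrite ffunE -fW (mem_iso_image iso) // fK // labm //.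
  case: ifPn => // xW; apply/eqP/negP => /negP lx; case/negP: xW.
  by apply: cW; rewrite inE.
apply/existsP; exists m'; apply/andP; split; last first.
  apply/fintype.subsetP => y; rewrite inE ffunE; case: ifP => //.
  by rewrite eqxx.
apply/and3P; split; last first.
- apply/forallP => y; apply/implyP; rewrite [m' y]ffunE -fW.
  case: ifP => [/imsetP[x xW ->]|//].
  have xN := fintype.subsetP WN x xW.
  by rewrite labm // fK // => lx; exact: (implyP (l'bot x)).
- by rewrite -fv m'f ?(fintype.subsetP WN).
apply: partial_solution_local => u.
(* Near [Z] the ball of [u] is a copy of a ball labeled by [l'] in [G]; farther away it misses [Z]
   and carries the labels of [m]. *)
case: (boolP (u \in nball r Z)) => [uZ|].
- have rN : r <= view_radius Pi by apply: leq_trans r2; exact: leq_addr.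
  move: uZ; rewrite -fW -ballW // => /imsetP[x xW ux].
  have x1W : [set x] \subset nball r W by rewrite finset.sub1set.
  have xrN : nball r [set x] \subset nball (view_radius Pi) W.
    apply: fintype.subset_trans (nballS r x1W) _.
    by rewrite -nballD leq_nball.
  exists G, l', x, f; split => //.
  have fball : f @: nball r [set x] = nball r [set u].
    by rewrite ball // imset_set1 ux.
  case: (labeled_iso_sub iso xrN fball) => inj' im adj' _; split => //.
  by move=> w wx; rewrite m'f // (fintype.subsetP xrN).
- rewrite -disjoint_nball1 => /pred0P dis.
  exists H, m, u, id; split=> //; apply: labeled_iso_id => y yu.
  by have /= := dis y; rewrite yu ffunE /= => ->.
Qed.

End IsoMend.
End Mends.

(** * The deterministic mender that grows balls *)

Section BallMender.
Variables (R : realType) (Pi : lcl).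

(* A state without a mend that has no neighbor outside misses v, by
   [contains_mend_closed], so it is not reachable; [setT] is only there to
   satisfy termination. *)
Definition ball_step (G : sgraph) (l : labeling (alphabet Pi) G) (v : G)
    (W : {set G}) : {set G} :=
  if contains_mend l v W then W
  else if cnbhd W == W then finset.setTfor G else cnbhd W.

Definition ball_trans (G : sgraph) (l : labeling (alphabet Pi) G) (v : G)
    (W X : {set G}) : R := (X == ball_step l v W)%:R%R.

Hypothesis mendable : always_mendable Pi.

Section Step.
Variables (G : sgraph) (l : labeling (alphabet Pi) G) (v : G).
Hypotheses (iG : instances Pi G) (psl : partial_solution l) (hv : hole l v).
Implicit Types W X : {set G}.

Lemma contains_mend_setT : contains_mend l v finset.setT.
Proof.
apply: contains_mend_closed => //.
by apply/eqP; rewrite finset.eqEsubset finset.subsetT subset_cnbhd.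
Qed.

Lemma ball_step_sub W : W \subset ball_step l v W.
Proof.
rewrite /ball_step; case: ifP => // _.
by case: ifP => _; rewrite ?finset.subsetT ?subset_cnbhd.
Qed.

(** The fallback state itself contains a mend, so a state without one always moves; this gives
    termination. *)
Lemma ball_step_fixed W : (W == ball_step l v W) = contains_mend l v W.
Proof.
rewrite /ball_step; case: ifPn => [_|nW]; first exact: eqxx.
case: ifPn => [_|]; last by rewrite eq_sym => /negPf.
by apply/negP => /eqP WT; case/negP: nW; rewrite WT contains_mend_setT.
Qed.

Lemma ball_step_cnbhd W : v \in W -> ~~ contains_mend l v W ->
  ball_step l v W = cnbhd W.
Proof.
move=> vW nW; rewrite /ball_step (negPf nW); case: eqP => // cW.
by case/negP: nW; apply: contains_mend_closed.
Qed.

Lemma ball_trans_sum1 W : (\sum_(X : {set G}) ball_trans l v W X = 1 :> R)%R.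
Proof.
rewrite (bigD1 (ball_step l v W)) //= /ball_trans eqxx big1 ?addr0 //.
by move=> X /negPf ->.
Qed.

Lemma ball_trans_gt0 W X : (0 < ball_trans l v W X)%R -> X = ball_step l v W.
Proof. by rewrite /ball_trans; case: eqP => //; rewrite ltxx. Qed.

Lemma ball_trans_fixed W : (ball_trans l v W W = 1)%R <-> contains_mend l v W.
Proof.
rewrite /ball_trans ball_step_fixed; case: contains_mend; split => //.
by move=> /eqP; rewrite eq_sym oner_eq0.
Qed.

End Step.

(** The view decides which case of [ball_step] applies: both having a mend and being closed under
    adjacency are preserved by [f]. *)
Lemma ball_trans_local (G H : sgraph) (l : labeling (alphabet Pi) G)
      (m : labeling (alphabet Pi) H) (v : G) (z : H) :
    instances Pi G -> partial_solution l -> hole l v ->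
    instances Pi H -> partial_solution m -> hole m z ->
    forall (W : {set G}) (Z : {set H}) (f : G -> H),
    labeled_iso (nball (view_radius Pi) W) (nball (view_radius Pi) Z)
      (fun x => (l x, x == v)) (fun y => (m y, y == z)) f ->
    f @: W = Z ->
    forall X : {set G}, X \subset nball (view_radius Pi) W ->
    ball_trans m z Z (f @: X) = ball_trans l v W X.
Proof.
move=> iG psl hv iH psm hz W Z f iso fW X XN.
have WN := subset_nball (view_radius Pi) W.
have mendE : contains_mend m z Z = contains_mend l v W.
  (* The converse transports the mend back along the inverse isomorphism. *)
  apply/idP/idP; last exact: (iso_contains_mend psm hv iso fW).
  have [g [iso' fK]] := labeled_iso_inv iso v.
  apply: (iso_contains_mend psl hz iso').
  rewrite -fW -imset_comp -[RHS]imset_id; apply: eq_in_imset => x xW.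
  by rewrite /= fK // (fintype.subsetP WN).
have view1 : 0 < view_radius Pi by rewrite leq_max.
have fcW : f @: cnbhd W = cnbhd Z.
  by rewrite -fW; apply: (iso_nball iso erefl _ view1); rewrite fW.
have cWN : cnbhd W \subset nball (view_radius Pi) W.
  exact: (leq_nball (j := 1)).
rewrite /ball_trans /ball_step mendE; case: ifPn => [_|nW].
  by rewrite -fW (iso_imset_eq iso).
have cE : (cnbhd Z == Z) = (cnbhd W == W).
  by rewrite -fcW -[in LHS]fW (iso_imset_eq iso).
rewrite cE; case: (cnbhd W =P W) => [cW|_]; last by rewrite -fcW (iso_imset_eq iso).
have cZ : cnbhd Z = Z by apply/eqP; rewrite cE cW.
(* In the fallback case [f] need not send all of [G] onto all of [H], but both probabilities vanish:
   [X] and its image lie in the closed sets [W] and [Z], which contain no mend and so are not the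
   full vertex sets. *)
congr ((nat_of_bool _)%:R)%R; transitivity false; last apply/esym.
  apply/negP => /eqP fXT; move: nW; rewrite -mendE => /negP; apply.
  suff -> : Z = finset.setT by exact: contains_mend_setT.
  apply/eqP; rewrite finset.eqEsubset finset.subsetT -fXT /= -fW imsetS //.
  by rewrite -(nball_closed (view_radius Pi) cW).
apply/negP => /eqP XT; case/negP: nW.
suff -> : W = finset.setT by exact: contains_mend_setT.
apply/eqP; rewrite finset.eqEsubset finset.subsetT -XT.
by rewrite -(nball_closed (view_radius Pi) cW).
Qed.

Definition ball_mender : mender R Pi.
Proof.
refine (@Mender R Pi ball_trans _ _ _ _ _ _).
- by move=> G l v _ _ _ W W'; rewrite ler0n.
- by move=> G l v _ _ _ W; exact: ball_trans_sum1.
- by move=> G l v _ _ _ W W' /ball_trans_gt0 ->; exact: ball_step_sub.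
- by move=> G l v iG psl hv W; exact: ball_trans_fixed.
- move=> G l v iG psl hv W W' vW /ball_trans_gt0 ->.
  have [mW|nW] := boolP (contains_mend l v W).
    by rewrite /ball_step mW subset_cnbhd.
  by rewrite ball_step_cnbhd.
- exact: ball_trans_local.
Defined.

Section Final.
Variables (G : sgraph) (l : labeling (alphabet Pi) G) (v : G).
Hypotheses (iG : instances Pi G) (psl : partial_solution l) (hv : hole l v).

(** The final state is the ball of least radius containing a mend; by minimality, each earlier step
    adds one full layer. *)
Lemma ball_mender_final K : contains_mend l v (nball K [set v]) ->
  exists2 k, k <= K & nball k [set v] \in final_states ball_mender l v.
Proof.
move=> mK; have exk : exists k, contains_mend l v (nball k [set v]) by exists K.
case: (ex_minnP exk) => k mk mink; exists k; first exact: mink.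
rewrite inE; apply/andP; split; last by apply/eqP/ball_trans_fixed.
suff: forall j, j <= k ->
    connect (fun A B => 0 < ball_mender G l v A B)%R [set v] (nball j [set v]).
  exact.
elim=> [|j IH] jk; first exact: connect0.
apply: connect_trans (IH (ltnW jk)) (connect1 _).
rewrite /= /ball_trans ball_step_cnbhd ?eqxx ?ltr01 //; first exact: mem_nball.
by apply: contraL jk => mj; rewrite -leqNgt mink.
Qed.

(** Along any path from [[set v]] the states are balls around [v], and growth stops at radius [K] at
    the latest. *)
Lemma ball_mender_final_sub K W : contains_mend l v (nball K [set v]) ->
  W \in final_states ball_mender l v -> W \subset nball K [set v].
Proof.
move=> mK; rewrite inE => /andP[/connectP[p path_p ->] _].
suff [j jK ->] : exists2 j, j <= K & last [set v] p = nball j [set v].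
  exact: leq_nball.
elim/last_ind: p path_p => [_|p A IH]; first by exists 0.
rewrite rcons_path last_rcons => /andP[/IH[j jK ->] /ball_trans_gt0 ->].
have [mj|nmj] := boolP (contains_mend l v (nball j [set v])).
  by exists j => //; rewrite /ball_step mj.
exists j.+1; last by rewrite ball_step_cnbhd //; exact: mem_nball.
by rewrite ltn_neqAle jK andbT; apply: contraNneq nmj => ->.
Qed.

End Final.
End BallMender.

(** * Convergence of the chain to its final states *)

Section Absorption.
Variables (R : realType) (Pi : lcl) (M : mender R Pi) (G : sgraph).
Variables (l : labeling (alphabet Pi) G) (v : G).
Hypotheses (iG : instances Pi G) (psl : partial_solution l) (hv : hole l v).
Implicit Types (U V W : {set G}) (k : nat).
Local Open Scope classical_set_scope.
Local Open Scope ring_scope.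

Local Notation P := (M G l v).
Local Notation mass k := (trans_iter M k l v).

Let P_ge0 := trans_ge0 M iG psl hv.
Let P_sum1 := trans_sum1 M iG psl hv.

Lemma trans_iter_ge0 k W U : 0 <= mass k W U.
Proof.
elim: k W => [|k IH] W /=; first exact: ler0n.
by apply: sumr_ge0 => V _; rewrite mulr_ge0.
Qed.

Lemma trans_iter_sum1 k W : \sum_U mass k W U = 1.
Proof.
elim: k W => [|k IH] W /=.
  by rewrite (bigD1 W) //= eqxx big1 ?addr0 // => U; rewrite eq_sym => /negPf ->.
rewrite exchange_big -[RHS](P_sum1 W); apply: eq_bigr => V _.
by rewrite -mulr_sumr IH mulr1.
Qed.

Lemma trans_iter_le1 k W U : mass k W U <= 1.
Proof.
rewrite -(trans_iter_sum1 k W) (bigD1 U) //= lerDl.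
by apply: sumr_ge0 => V _; exact: trans_iter_ge0.
Qed.

(** Splits off the last step instead of the first, to compare the distributions at consecutive
    times. *)
Lemma trans_iterSr k W W' : mass k.+1 W W' = \sum_U mass k W U * P U W'.
Proof.
elim: k W => [|k IH] W.
  rewrite /= (bigD1 W') //= eqxx mulr1 big1 ?addr0; last first.
    by move=> U /negPf ->; rewrite mulr0.
  rewrite (bigD1 W) //= eqxx mul1r big1 ?addr0 // => U.
  by rewrite eq_sym => /negPf ->; rewrite mul0r.
rewrite [LHS]/=; under eq_bigr do rewrite -/(mass k.+1 _ W') IH mulr_sumr.
rewrite exchange_big; apply: eq_bigr => U _ /=; rewrite mulr_suml.
by apply: eq_bigr => V _; rewrite mulrA.
Qed.

Lemma trans_iter_connect k W U :
  mass k W U != 0 -> connect (fun A B => 0 < P A B) W U.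
Proof.
elim: k W => [|k IH] W /=.
  by case: (W =P U) => [-> _|_]; rewrite ?connect0 ?eqxx.
move=> nz; have [V /andP[PV mV]] : exists V, (P W V != 0) && (mass k V U != 0).
  apply/existsP; apply: contraNT nz => /existsPn no; apply/eqP/big1 => V _.
  by apply/eqP; rewrite mulf_eq0 -[_ || _]negbK negb_or no.
apply: connect_trans (IH _ mV); apply: connect1.
by rewrite lt_neqAle eq_sym PV P_ge0.
Qed.

(** By progress, every move that leaves [V] adds at least one vertex, and [1 - P V V] is the
    probability of leaving. *)
Lemma expected_size_step V :
  #|V|%:R + (1 - P V V) <= \sum_U P V U * #|U|%:R.
Proof.
have -> : 1 - P V V = \sum_(U | U != V) P V U.
  by apply/eqP; rewrite subr_eq addrC -(P_sum1 V) (bigD1 V).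
have -> : #|V|%:R = \sum_U P V U * #|V|%:R by rewrite -mulr_suml P_sum1 mul1r.
rewrite [X in _ + X]big_mkcond -big_split ler_sum //= => U _.
have [->|UV] := eqVneq U V; first by rewrite addr0.
have [PU|PU0] := ltP 0 (P V U); last first.
  suff -> : P V U = 0 by rewrite !mul0r addr0.
  by apply/eqP; rewrite eq_le PU0 P_ge0.
rewrite -{2}(mulr1 (P V U)) -mulrDr ler_pM2l // -(natrD _ _ 1) ler_nat addn1.
apply: proper_card; rewrite finset.properEneq eq_sym UV.
exact: progress iG psl hv _ _ PU.
Qed.

(** A potential for the chain, nondecreasing in [k] and bounded by [#|G|]; its convergence forces
    absorption. *)
Definition expected_size W k : R := \sum_U mass k W U * #|U|%:R.

Lemma expected_sizeS W k :
  expected_size W k + \sum_U mass k W U * (1 - P U U) <= expected_size W k.+1.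
Proof.
rewrite /expected_size -big_split /=.
under [leRHS]eq_bigr do rewrite -/(mass k.+1 _ _) trans_iterSr mulr_suml.
rewrite exchange_big; apply: ler_sum => V _ /=.
under [leRHS]eq_bigr do rewrite -mulrA.
rewrite -mulr_sumr -mulrDr ler_wpM2l ?trans_iter_ge0 //.
exact: expected_size_step.
Qed.

Lemma trans_le1 U W : P U W <= 1.
Proof.
by rewrite -(P_sum1 U) (bigD1 W) //= lerDl; apply: sumr_ge0.
Qed.

Lemma cvg_expected_size W : cvgn (expected_size W).
Proof.
apply: nondecreasing_is_cvgn.
  apply/nondecreasing_seqP => k; apply: le_trans (expected_sizeS W k).
  rewrite lerDl; apply: sumr_ge0 => U _.
  by rewrite mulr_ge0 ?trans_iter_ge0 // subr_ge0 trans_le1.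
exists #|G|%:R => _ [k _ <-]; have -> : #|G|%:R = \sum_U mass k W U * #|G|%:R.
  by rewrite -mulr_suml trans_iter_sum1 mul1r.
apply: ler_sum => U _.
by rewrite ler_wpM2l ?trans_iter_ge0 // ler_nat max_card.
Qed.

(* The increments of the convergent expected size dominate the mass of a
   transient state, up to the constant factor 1 - P U U. *)
Lemma cvg_trans_iter_transient W U : P U U != 1 ->
  (fun k => mass k W U) @ \oo --> (0 : R).
Proof.
move=> PU; have d_gt0 : 0 < 1 - P U U by rewrite subr_gt0 lt_neqAle PU trans_le1.
pose incr k := (expected_size W k.+1 - expected_size W k) / (1 - P U U).
have incr0 : incr @ \oo --> (0 : R).
  rewrite -(mul0r (1 - P U U)^-1) -(subrr (limn (expected_size W))).
  apply: cvgM; last exact: cvg_cst.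
  apply: cvgB; last exact: cvg_expected_size.
  by rewrite (cvg_shiftS (expected_size W)); exact: cvg_expected_size.
apply: (squeeze_cvgr _ (cvg_cst 0) incr0); apply: nearW => k.
rewrite trans_iter_ge0 ler_pdivlMr //= lerBrDl.
apply: le_trans (expected_sizeS W k); rewrite lerD2l (bigD1 U) //= lerDl.
apply: sumr_ge0 => V _; rewrite mulr_ge0 ?trans_iter_ge0 //.
by rewrite subr_ge0 trans_le1.
Qed.

(** The mass of an absorbing state can only grow and is at most 1; that of any other state tends to
    0. *)
Lemma cvg_trans_iter W U : cvgn (fun k => mass k W U).
Proof.
have [PU|PU] := eqVneq (P U U) 1; last first.
  by apply: cvgP; exact: cvg_trans_iter_transient.
apply: nondecreasing_is_cvgn; last first.
  by exists 1 => _ [k _ <-]; exact: trans_iter_le1.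
apply/nondecreasing_seqP => k; rewrite trans_iterSr (bigD1 U) //= PU mulr1 lerDl.
by apply: sumr_ge0 => V _; rewrite mulr_ge0 ?trans_iter_ge0.
Qed.

Lemma limit_distribution_ge0 W U : 0 <= limit_distribution M l v W U.
Proof.
apply: limr_ge; first exact: cvg_trans_iter.
by apply: nearW => k; exact: trans_iter_ge0.
Qed.

Lemma limit_distribution_sum1 W : \sum_U limit_distribution M l v W U = 1.
Proof.
have lim_sum : (fun k => \sum_U mass k W U) @ \oo -->
    \sum_U limit_distribution M l v W U.
  apply: cvg_big => [|U _]; last exact: cvg_trans_iter.
  exact: add_continuous.
have -> : 1 = limn (fun k => \sum_U mass k W U) :> R.
  by under eq_fun do rewrite trans_iter_sum1; rewrite lim_cst.
by apply/esym/cvg_lim.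
Qed.

(** A state that is not final is either unreachable from [[set v]], with mass 0 at all times, or
    transient, with mass tending to 0. *)
Lemma limit_distribution_final :
  \sum_(W in final_states M l v) limit_distribution M l v [set v] W = 1.
Proof.
rewrite -(limit_distribution_sum1 [set v]).
rewrite [RHS](bigID (mem (final_states M l v))) /=.
rewrite [X in _ + X]big1 ?addr0 // => U; rewrite inE negb_and.
case/orP => [nconn|PU]; last exact/cvg_lim/cvg_trans_iter_transient.
rewrite /limit_distribution (_ : (fun k => _) = cst 0) ?lim_cst //.
apply/funext => k; apply/eqP; apply: contraNT nconn; exact: trans_iter_connect.
Qed.

End Absorption.

(** * Comparison of the measures on a single instance *)

Section Comparisons.
Variables (R : realType) (Pi : lcl).
Hypothesis mendable : always_mendable Pi.

Lemma bigmin_leq (I : finType) (P : pred I) (F : I -> nat) n i :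
  P i -> \big[minn/n]_(j | P j) F j <= F i.
Proof.
move=> Pi0; have := mem_index_enum i; elim: (index_enum I) => // j s IH.
rewrite inE big_cons => /predU1P[<-|/IH le]; first by rewrite Pi0 geq_minl.
by case: ifP => // _; rewrite geq_min le orbT.
Qed.

Lemma leq_bigmin (I : finType) (P : pred I) (F : I -> nat) n m :
  m <= n -> (forall i, P i -> m <= F i) -> m <= \big[minn/n]_(j | P j) F j.
Proof.
move=> mn mF; elim/big_ind: _ => // a b ma mb.
by rewrite leq_min ma mb.
Qed.

Section Instance.
Variable G : sgraph.
Hypothesis iG : instances Pi G.

Lemma MRad_ball_mender_le :
  MRad (ball_mender R mendable) G <= 2 * radius Pi * existsMVol Pi G.
Proof.
apply/bigmax_leqP => -[l v] /[dup] adm /andP[/= psl hv].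
suff [l' ml' cl'] : exists2 l', mend l v l' &
    #|changed l l'| <= \big[minn/#|G|]_(l' | mend l v l') #|changed l l'|.
  have mK := contains_mend_nball psl hv ml'.
  have [k kK final] := ball_mender_final R mendable iG psl hv mK.
  apply: leq_trans (bigmin_leq _ _ final) _.
  apply/bigmax_leqP => w /dist_le dk; apply: leq_trans dk _.
  apply: leq_trans kK _; rewrite leq_mul2l (leq_trans cl') ?orbT //.
  exact: (@leq_bigmax_cond _ (@admissible Pi G) _ (l, v) adm).
(* The minimum is bounded below by a cheapest mend: mends exist, and the neutral element [#|G|] is
   at least the cost of any of them. *)
have [l0 ml0] := mendable iG psl hv.
case: (arg_minnP (fun l' => #|changed l l'|) ml0) => l' ml' minl'.
by exists l' => //; apply: leq_bigmin; [exact: max_card|exact: minl'].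
Qed.

(** Every final state contains a mend, hence has at least as many vertices as a cheapest mend
    changes; averaging over a probability distribution preserves this bound. *)
Lemma existsMVol_le_EMVol (M : mender R Pi) :
  ((existsMVol Pi G)%:R <= EMVol M G)%R.
Proof.
rewrite /existsMVol; elim/big_ind: _ => [|a b|[l v] /[dup] adm /andP[/= psl hv]].
- exact: bigmax_ge_id.
- by rewrite /maxn; case: ifP.
apply: le_trans (@le_bigmax_cond _ _ _ _ (l, v) (@admissible Pi G) _ adm) => /=.
set c := \big[_/_]_(_ | _) _.
have -> : (c%:R = \sum_(W in final_states M l v)
    limit_distribution M l v [set v] W * c%:R :> R)%R.
  by rewrite -mulr_suml limit_distribution_final // mul1r.
apply: ler_sum => W; rewrite inE => /andP[_ /eqP/(termination M iG psl hv) mW].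
apply: ler_wpM2l; first exact: limit_distribution_ge0.
case/existsP: mW => l' /andP[ml' /subset_leq_card cW].
by rewrite ler_nat; apply: leq_trans cW; exact: bigmin_leq.
Qed.

Lemma EMVol_le_DMVol (M : mender R Pi) : (EMVol M G <= (DMVol M G)%:R)%R.
Proof.
apply: bigmax_le => [|[l v] /[dup] adm /andP[/= psl hv]]; first exact: ler0n.
have -> : ((DMVol M G)%:R = \sum_(W in final_states M l v)
    limit_distribution M l v [set v] W * (DMVol M G)%:R :> R)%R.
  by rewrite -mulr_suml limit_distribution_final // mul1r.
apply: ler_sum => W finW; apply: ler_wpM2l; first exact: limit_distribution_ge0.
rewrite ler_nat.
apply: leq_trans (@leq_bigmax_cond _ (@admissible Pi G) _ (l, v) adm).
exact: (@leq_bigmax_cond _ (mem (final_states M l v)) (fun W => #|W|) W finW).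
Qed.

(** A final state contains a mend and lies in the ball around [v] whose radius is its eccentricity,
    so that ball contains a mend too. *)
Lemma contains_mend_MRad (M : mender R Pi) l v :
  @admissible Pi G (l, v) -> contains_mend l v (nball (MRad M G) [set v]).
Proof.
move=> /[dup] adm /andP[/= psl hv].
pose rad := \big[minn/#|G|]_(W in final_states M l v) \max_(w in W) dist v w.
suff : contains_mend l v (nball rad [set v]).
  apply: contains_mendS; apply: leq_nball.
  exact: (@leq_bigmax_cond _ (@admissible Pi G) _ (l, v) adm).
(* Balls of radius at least [#|G|] are closed under adjacency. This covers the neutral element of
   the minimum and the value [#|G|] that [dist] takes between components. *)
have mG K : #|G| <= K -> contains_mend l v (nball K [set v]).
  move=> GK; apply: contains_mendS (leq_nball _ GK) _.
  apply: contains_mend_closed => //; first exact: mem_nball.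
  exact: cnbhd_nball_card.
rewrite /rad; elim/big_ind: _ => [|a b ma mb|W].
- exact: mG.
- by rewrite /minn; case: ifP.
rewrite inE => /andP[_ /eqP/(termination M iG psl hv) mW].
set d := \max_(w in W) dist v w; have [/mG //|dG] := leqP #|G| d.
apply: contains_mendS mW; apply/fintype.subsetP => w wW.
have wd : dist v w <= d by exact: (@leq_bigmax_cond _ (mem W)).
apply: (fintype.subsetP (leq_nball _ wd)); apply: mem_nball_dist.
exact: leq_ltn_trans wd dG.
Qed.

Lemma DMVol_ball_mender_le (M : mender R Pi) :
  DMVol (ball_mender R mendable) G <= NMRad M G.
Proof.
apply/bigmax_leqP => -[l v] /[dup] adm /andP[/= psl hv].
apply/bigmax_leqP => W finW.
have mM := contains_mend_MRad M adm.
apply: leq_trans (subset_leq_card (ball_mender_final_sub iG psl hv mM finW)) _.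
exact: (leq_bigmax (F := fun u : G => #|nball (MRad M G) [set u]|)).
Qed.

End Instance.

Lemma bigO_instances_le (X Y : sgraph -> R) (T : nat -> R) (c : R) :
  (0 <= c)%R -> (forall G, instances Pi G -> (X G <= c * Y G)%R) ->
  bigO_instances Pi Y T -> bigO_instances Pi X T.
Proof.
move=> c0 XY [C [n0 YT]]; exists (c * C)%R, n0 => G iG nG.
rewrite -mulrA; apply: le_trans (XY G iG) _.
by apply: ler_wpM2l => //; exact: YT.
Qed.

End Comparisons.

Theorem mainTheorem4 (R : realType) (Pi : lcl)
    (bounded : bounded_degree Pi) (mendable : always_mendable Pi)
    (T : nat -> R) :
  [/\ existsMVol_bigO Pi T -> MRad_bigO Pi T,
      EMVol_bigO Pi T -> existsMVol_bigO Pi T,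
      DMVol_bigO Pi T -> EMVol_bigO Pi T &
      NMRad_bigO Pi T -> DMVol_bigO Pi T].
Proof.
split.
- move=> O; exists (ball_mender R mendable).
  (* The factor [2 * radius Pi] depends on the problem alone. *)
  apply: bigO_instances_le O; first exact: (ler0n R (2 * radius Pi)).
  by move=> G iG; rewrite -natrM ler_nat MRad_ball_mender_le.
- move=> [M]; apply: (bigO_instances_le ler01) => G iG.
  by rewrite mul1r existsMVol_le_EMVol.
- move=> [M O]; exists M; apply: (bigO_instances_le ler01) O => G iG.
  by rewrite mul1r EMVol_le_DMVol.
(* The witness changes from [M] to the ball mender, all of whose final states fit in balls of radius
   [MRad M G]. *)
- move=> [M [_ O]]; exists (ball_mender R mendable).
  apply: (bigO_instances_le ler01) O => G iG.
  by rewrite mul1r ler_nat DMVol_ball_mender_le.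
Qed.
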